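(* If $p$, $q$ and $r$ are distinct primes, then every skew morphism of the cyclic group $\mathrm{C}_{pqr}$ is coset-preserving.
   Context: For a finite group $B$, a skew morphism of $B$ is a permutation $\varphi$ of $B$ fixing the identity such that for every $a\in B$ there is a positive integer $i_a$ with $\varphi(ab)=\varphi(a)\varphi^{i_a}(b)$ for all $b\in B$. Its order $\mathrm{ord}(\varphi)$ is the order of $\langle\varphi\rangle$. The power function $\pi$ maps $a$ to the unique such $i_a\in\{1,\dots,\mathrm{ord}(\varphi)\}$ (with $\pi\equiv1$ for the identity). $\varphi$ is coset-preserving if $\pi(\varphi(a))=\pi(a)$ for all $a\in B$. *)

(* Defs.v *)
(* Mathematical Components. *)
From mathcomp Require Import all_boot all_fingroup all_solvable.

Set Implicit Arguments.
Unset Strict Implicit.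
Unset Printing Implicit Defensive.

Import GroupScope.

Section SkewMorphisms.

Variable gT : finGroupType.
Implicit Types (phi : {perm gT}) (a : gT) (i : nat).

Definition skew_exponent phi a i : bool :=
  [forall b, phi (a * b) == phi a * (phi ^+ i) b].

Definition skew_morphism phi : Prop :=
  phi 1 = 1 /\ forall a, exists2 i, 0 < i & skew_exponent phi a i.

(* The first exponent of a in {1, ..., #[phi]}; it is the only one there by   *)
(* skew_power_unique, and 0 is a junk value not taken by skew morphisms.      *)
Definition skew_power phi a : nat :=
  head 0 [seq i <- iota 1 #[phi] | skew_exponent phi a i].

Definition coset_preserving phi : Prop :=
  forall a, skew_power phi (phi a) = skew_power phi a.

Lemma skew_exponent_inj phi a i j :
  0 < i <= #[phi] -> 0 < j <= #[phi] ->
  skew_exponent phi a i -> skew_exponent phi a j -> i = j.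
Proof.
case: i j => // i [|j] //= ilt jlt /forallP hi /forallP hj.
have /eqP : phi ^+ i.+1 = phi ^+ j.+1.
  by apply/permP=> b; apply: (mulgI (phi a)); rewrite -(eqP (hi b)) (eqP (hj b)).
by rewrite eq_expg_mod_order -addn1 -(addn1 j) eqn_modDr !modn_small // => /eqP->.
Qed.

Lemma skew_powerP phi a :
  skew_morphism phi ->
  0 < skew_power phi a <= #[phi] /\ skew_exponent phi a (skew_power phi a).
Proof.
case=> _ /(_ a)[i i0 hi].
suff: skew_power phi a \in [seq i <- iota 1 #[phi] | skew_exponent phi a i].
  by rewrite mem_filter mem_iota add1n ltnS => /andP[].
have [k kin]: exists k, k \in [seq i <- iota 1 #[phi] | skew_exponent phi a i].
  exists (i.-1 %% #[phi]).+1; rewrite mem_filter mem_iota add1n !ltnS ltn_pmod //=.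
  rewrite andbT; apply/forallP=> b.
  by rewrite expgS expg_mod_order -expgS prednK // (forallP hi).
by rewrite /skew_power; case: [seq _ <- _ | _] kin => // x s _; apply: mem_head.
Qed.

Lemma skew_power_unique phi a i :
  skew_morphism phi -> 0 < i <= #[phi] -> skew_exponent phi a i ->
  i = skew_power phi a.
Proof.
by move=> /(skew_powerP a)[rp ep] ri ei; apply: skew_exponent_inj ei ep.
Qed.

End SkewMorphisms.

(* Main.v *)
(* The translations [A] and the cycle [C] of [phi] form a group [G = A * C] in
   which [C] is core-free, and [phi] is coset-preserving as soon as [K * C]
   contains [G^`(1)], where [K] is the core of [A]: then [phi] fixes every
   coset of [K], and [K] normal in [G] makes the exponent constant on them.
   By Ito's theorem [G^`(1)] is abelian; let [F] be a maximal abelian subgroup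
   containing it, so that [F] is normal and self-centralising. For a prime [s],
   the index of ['O_s(F) :&: C] in ['O_s(F)] divides the squarefree number
   [#|A|], and core-freeness makes ['O_s(F)] elementary abelian of order at most
   [s ^ 2]. In order [s ^ 2], [C] centralises ['O_s(F)], which is then the
   product of subgroups of [A] and [C], the first of them central in [G]. In
   order [s], ['O_s(F)] lies in [A]: otherwise the same failure would occur for
   a larger prime. Hence [F], and so [G^`(1)], is contained in [K * C]. *)
Require Import Defs.
From mathcomp Require Import all_boot all_fingroup all_solvable.

Set Implicit Arguments.
Unset Strict Implicit.
Unset Printing Implicit Defensive.

Import GroupScope.

(** * Derived subgroups and abelian subgroups containing them *)

(* Ito: conjugating [~ a, b] by u * v or by v * u gives the same result. *)
Lemma der1_mul_abelian (gT : finGroupType) (A B G : {group gT}) :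
  A * B = G -> abelian A -> abelian B -> abelian G^`(1).
Proof.
move=> defG cAA cBB.
have commA x y z : x \in A -> y \in A -> [~ x, y * z] = [~ x, z].
  move=> Ax Ay; rewrite commgMJ; have /commgP/eqP -> := centsP cAA _ Ax _ Ay.
  by rewrite conj1g mulg1.
have commB x y z : x \in B -> z \in B -> [~ x * y, z] = [~ y, z].
  move=> Bx Bz; rewrite commMgJ; have /commgP/eqP -> := centsP cBB _ Bx _ Bz.
  by rewrite conj1g mul1g.
have defGr : B * A = G.
  by rewrite -defG; apply/esym/comm_group_setP; rewrite defG groupP.
have cAJ x y : x \in A -> y \in A -> x ^ y = x.
  by move=> Ax Ay; rewrite conjgE (centsP cAA _ Ax _ Ay) mulKg.
have cBJ x y : x \in B -> y \in B -> x ^ y = x.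
  by move=> Bx By; rewrite conjgE (centsP cBB _ Bx _ By) mulKg.
have sAG : A \subset G by rewrite -defG mulG_subl.
have sBG : B \subset G by rewrite -defG mulG_subr.
have conjC a b u v : a \in A -> b \in B -> u \in A -> v \in B ->
  [~ a, b] ^ (u * v) = [~ a, b] ^ (v * u).
- move=> Aa Bb Au Bv.
  have: b ^ u \in A * B by rewrite defG groupJ ?(subsetP sAG u) ?(subsetP sBG).
  case/mulsgP=> a2 b2 Aa2 Bb2 def_bu.
  have: a ^ v \in B * A by rewrite defGr groupJ ?(subsetP sAG a) ?(subsetP sBG).
  case/mulsgP=> b3 a3 Bb3 Aa3 def_av.
  (* Both sides reduce to [[~ a3, b2]]. *)
  rewrite !conjgM conjRg (cAJ a u) // def_bu commA // conjRg def_av (cBJ b2 v) //.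
  rewrite commB // conjRg def_av (cBJ b v) // commB // conjRg (cAJ a3 u) //.
  by rewrite def_bu commA.
have cRR : abelian [~: A, B].
  rewrite abelian_gen; apply/centsP=> _ /imset2P[a b Aa Bb ->].
  move=> _ /imset2P[u v Au Bv ->]; apply/commgP/conjg_fixP.
  have -> : [~ u, v] = (u^-1 * v^-1) * (u * v) by rewrite /commg /conjg !mulgA.
  by rewrite conjgM conjC ?groupV // -conjgM -invMg mulVg conjg1.
(* Modulo [[~: A, B]] the images of [A] and [B] are abelian and commute, so the quotient of [G] is
   abelian. *)
apply: abelianS cRR; apply: der1_min.
  have /normal_norm := commg_normal A B.
  by apply: subset_trans; rewrite -defG mulG_subG joing_subl joing_subr.
have [nRA nRB] : A \subset 'N([~: A, B]) /\ B \subset 'N([~: A, B]).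
  by rewrite commg_norml commg_normr.
rewrite -defG quotientMl // abelianM !quotient_abelian //=.
by rewrite quotient_cents2 // commGC.
Qed.

(** A finite group is generated by its Sylow subgroups, and those of a nilpotent group are its
    ['O_p(F)]. *)
Lemma nilpotent_pcore_notin (gT : finGroupType) (F H : {group gT}) :
  nilpotent F -> ~~ (F \subset H) -> exists2 p, prime p & ~~ ('O_p(F) \subset H).
Proof.
move=> nilF; have [/existsP[P /andP[/SylowP[p p_pr sylP] nsPH]] _|] :=
  boolP [exists P : {group gT}, Sylow F P && ~~ (P \subset H)].
  by exists p; rewrite // -(nilpotent_Hall_pcore nilF sylP).
rewrite negb_exists => /forallP sSyl /negP[].
rewrite -(Sylow_gen F) gen_subG; apply/bigcupsP=> P sylP.
by have := sSyl P; rewrite sylP negbK.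
Qed.

Lemma der1_maximal_abelian (gT : finGroupType) (G : {group gT}) :
  abelian G^`(1) ->
  exists F : {group gT},
    [/\ abelian F, G^`(1) \subset F, F \subset G & 'C_G(F) \subset F].
Proof.
move=> cG'.
pose P (F : {set gT}) := abelian F && (F \subset G).
have [|F /maxgroupP[/andP[cFF sFG] maxF] sG'F] := @maxgroup_exists _ P G^`(1)%G.
  by rewrite /P /= cG' der_sub.
exists F; split=> //; apply/subsetP=> x /setIP[Gx cFx].
rewrite -cycle_subG -(maxF (F <*> <[x]>)%G) ?joing_subl ?joing_subr //.
by rewrite /P /= abelianY cFF cycle_abelian cycle_subG cFx join_subG sFG cycle_subG.
Qed.

(** * Products of two cyclic groups, one of squarefree order and the other core-free *)

Section CyclicFactorization.

Variables (gT : finGroupType) (A C G F : {group gT}).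
Hypotheses (defG : A * C = G) (cycA : cyclic A) (cycC : cyclic C).
Hypothesis sqfA : forall s, logn s #|A| <= 1.
Hypothesis coreC : forall N : {group gT}, N <| G -> N \subset C -> N :=: 1.
Hypotheses (cFF : abelian F) (sG'F : G^`(1) \subset F) (sFG : F \subset G).
Hypothesis sCF : 'C_G(F) \subset F.

Let sAG : A \subset G. Proof. by rewrite -defG mulG_subl. Qed.
Let sCG : C \subset G. Proof. by rewrite -defG mulG_subr. Qed.
Let cAA : abelian A. Proof. exact: cyclic_abelian. Qed.
Let cCC : abelian C. Proof. exact: cyclic_abelian. Qed.

Let nsRG s : 'O_s(F) <| G.
Proof. exact: char_normal_trans (pcore_char _ _) (sub_der1_normal sG'F sFG). Qed.

Let nCR s : C \subset 'N('O_s(F)).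
Proof. exact: subset_trans sCG (normal_norm (nsRG s)). Qed.

Let sRG s : 'O_s(F) \subset G. Proof. exact: normal_sub. Qed.

Let cRF s : F \subset 'C('O_s(F)).
Proof. exact: sub_abelian_cent2 (pcore_sub _ _). Qed.

(** Both abelian factors normalise the intersection, so it is a normal subgroup of [G] inside the
    core-free [C]. *)
Lemma TI_cyclic_factors : A :&: C = 1.
Proof.
apply: (@coreC (A :&: C)%G); last exact: subsetIr.
rewrite /normal subIset ?sAG //= -defG mulG_subG.
by rewrite !sub_abelian_norm ?subsetIl ?subsetIr.
Qed.

Lemma pcore_mul_group s : group_set ('O_s(F) * C).
Proof. exact/comm_group_setP/commute_sym/normC/nCR. Qed.

Let RC s := Group (pcore_mul_group s).

(** This subgroup of [A] complements [C] in [RC s], so it mirrors ['O_s(F)] modulo [C]. *)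
Let pcoreA s := (A :&: RC s)%G.

Lemma pcoreA_mulC s : pcoreA s * C = 'O_s(F) * C.
Proof.
rewrite [pcoreA s : {set gT}]setIC (group_modr _ (mulG_subr _ _ : C \subset RC s)) defG.
by apply/setIidPl; rewrite /= mulG_subG sRG.
Qed.

Lemma card_pcoreA s : #|pcoreA s| = #|'O_s(F) : 'O_s(F) :&: C|.
Proof.
have tiAs : pcoreA s :&: C = 1.
  by apply/trivgP; rewrite -TI_cyclic_factors setSI ?subsetIl.
apply/eqP; rewrite -(eqn_pmul2r (cardG_gt0 C)) -(TI_cardMg tiAs) pcoreA_mulC.
by rewrite indexgI LagrangeMr.
Qed.

(** The order is a power of [s] dividing the squarefree [#|A|]; order 1 would put the normal
    subgroup ['O_s(F)] inside [C]. *)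
Lemma card_pcoreA_prime s : prime s -> 'O_s(F) != 1 -> #|pcoreA s| = s.
Proof.
move=> s_pr ntR.
have [k oAs]: {k | #|pcoreA s| = s ^ k}%N.
  apply: p_natP; rewrite card_pcoreA.
  exact: pnat_dvd (dvdn_indexg _ _) (pcore_pgroup s F).
have k_le1: k <= 1.
  have := dvdn_leq_log s (cardG_gt0 A) (cardSg (subsetIl A (RC s))).
  by rewrite oAs pfactorK // => /leq_trans->.
case: k oAs k_le1 => [|[|//]] // oAs _; case/negP: ntR; apply/eqP.
apply: coreC (nsRG s) _; move/eqP: oAs.
by rewrite card_pcoreA expn0 indexg_eq1 subsetI subxx.
Qed.

(** As ['O_s(F) :&: C] has index [s], all [s]-th powers lie in [C]. They generate a characteristic
    subgroup of ['O_s(F)], which core-freeness kills. *)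
Lemma pcore_abelem s : prime s -> s.-abelem 'O_s(F).
Proof.
move=> s_pr; have [->|ntR] := eqVneq 'O_s(F) 1; first exact: abelem1.
have cRR : abelian 'O_s(F) := abelianS (pcore_sub _ _) cFF.
rewrite abelemE // cRR; apply/exponentP=> x Rx.
suff sMho : 'Mho^1('O_s(F)) \subset C.
  have Mho1 : 'Mho^1('O_s(F)) = 1.
    apply: (coreC (N := 'Mho^1('O_s(F))%G)) sMho.
    by apply: char_normal_trans (nsRG s); apply: Mho_char.
  have := Mho_p_elt 1 Rx (mem_p_elt (pcore_pgroup s F) Rx).
  by rewrite Mho1 expn1 => /set1gP.
rewrite (MhoE _ (pcore_pgroup s F)) gen_subG; apply/subsetP=> _ /imsetP[y Ry ->].
have nDy : y \in 'N('O_s(F) :&: C).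
  by rewrite (subsetP _ _ Ry) // sub_abelian_norm ?subsetIl.
have : y ^+ s \in 'O_s(F) :&: C; last by rewrite expn1 => /setIP[].
apply: coset_idr; rewrite ?groupX // morphX //.
have := expg_cardG (mem_quotient ('O_s(F) :&: C) Ry).
rewrite card_quotient ?sub_abelian_norm ?subsetIl //.
by rewrite -card_pcoreA card_pcoreA_prime.
Qed.

(** The two products differ by a commutator, which lies in [F] and so centralises ['O_s(F)]. *)
Lemma cent_action_comm s g h x :
  g \in G -> h \in G -> x \in 'O_s(F) -> x ^ (g * h) = x ^ (h * g).
Proof.
move=> Gg Gh Rx; rewrite [g * h]commgC conjgM; apply/conjg_fixP/commgP.
have Rxhg : x ^ (h * g) \in 'O_s(F).
  by rewrite memJ_norm // (subsetP (normal_norm (nsRG s))) ?groupM.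
by apply/commute_sym/(centsP (cRF s)) => //; rewrite (subsetP sG'F) ?mem_commg.
Qed.

(* Elements of [G] act on ['O_s(F)] by commuting automorphisms, so ['C_R(C)] is
   normal in [G]; it properly contains ['O_s(F) :&: C], which has prime index. *)
Lemma pcore_meet_nontrivial s :
  prime s -> 'O_s(F) :&: C != 1 ->
  C \subset 'C('O_s(F)) /\ 'O_s(F) \subset gcore A G * C.
Proof.
move=> s_pr ntD; set R := 'O_s(F)%G; set D := (R :&: C)%G.
have abelR : s.-abelem R := pcore_abelem s_pr.
have ntR : R :!=: 1 by apply: contraNneq ntD => /= ->; rewrite (setIidPl (sub1G _)).
have oD : #|D| = s.
  apply: cyclic_abelem_prime ntD; first exact: abelemS (subsetIl _ _) abelR.
  exact: cyclicS (subsetIr _ _) cycC.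
have oAs : #|pcoreA s| = s := card_pcoreA_prime s_pr ntR.
have oR : #|R| = (s * s)%N.
  by rewrite -(Lagrange (subsetIl R C)) oD -card_pcoreA oAs.
have sDG : D \subset G by rewrite subIset ?sRG.
have cCR : C \subset 'C(R).
  have nCCR : 'C_R(C) <| G.
    rewrite /normal subIset ?sRG //=; apply/subsetP=> g Gg.
    rewrite inE; apply/subsetP=> _ /imsetP[x /setIP[Rx cCx] ->].
    rewrite inE memJ_norm ?(subsetP (normal_norm (nsRG s))) // Rx /=.
    apply/centP=> c Cc; apply/commgP/conjg_fixP.
    rewrite -conjgM (cent_action_comm Gg _ Rx) ?(subsetP sCG) // conjgM.
    by congr (_ ^ g); apply/conjg_fixP/commgP/(centP cCx).
  have sDC : D \subset 'C_R(C) by rewrite setIS // sub_abelian_cent.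
  have oDC : D :!=: 'C_R(C).
    apply: contraNneq ntD => defD; apply/eqP.
    by apply: (coreC (N := D)); rewrite ?subsetIr // defD.
  have : 'C_R(C) == R.
    rewrite eqEcard subsetIl oR /=.
    have: #|D| < #|'C_R(C)| by rewrite proper_card // properEneq oDC.
    have: #|'C_R(C)| %| s ^ 2 by rewrite expnS expn1 -oR cardSg ?subsetIl.
    case/(dvdn_pfactor _ _ s_pr)=> [[|[|[|//]]] _ ->] //; rewrite oD ?ltnn //.
    by rewrite ltnNge expn0 prime_gt0.
  by move/eqP/setIidPl; rewrite centsC.
split=> //.
have sAR : pcoreA s \subset R.
  apply/subsetP=> a Asa; have /setIP[Aa /mulsgP[r c Rr Cc def_a]] := Asa.
  have cs1 : c ^+ s = 1.
    have := expg_cardG Asa; rewrite oAs def_a expgMn; last first.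
      by apply/commute_sym/(centsP cCR).
    by have [_ ->] := abelemP s_pr abelR; rewrite ?mul1g.
  (* The cyclic group [C] has only one subgroup of order [s], namely [D]. *)
  have Dc : c \in D.
    rewrite -cycle_subG -(cardSg_cyclic cycC) ?cycle_subG ?subsetIr //.
    by rewrite oD order_dvdn cs1.
  by rewrite def_a groupM // (subsetP (subsetIl R C)).
have tiAD : pcoreA s :&: D = 1.
  by apply/trivgP; rewrite -TI_cyclic_factors setISS ?subsetIl ?subsetIr.
have defR : pcoreA s * D = R.
  apply/eqP; rewrite eqEcard mulG_subG sAR subsetIl.
  by rewrite TI_cardMg // oR oAs oD leqnn.
have sRAD : 'O_s(F) \subset pcoreA s * D by rewrite defR.
apply: subset_trans sRAD _.
(* Both [A] and [C] centralise [pcoreA s], so it is normal in [G] and lies in the core of [A]. *)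
rewrite mulgSS ?subsetIr // gcore_max ?subsetIl //.
rewrite -defG mulG_subG !cents_norm //.
  by rewrite (subset_trans cCR) ?centS.
by rewrite (subset_trans cAA) ?centS ?subsetIl.
Qed.

Lemma card_pcore_TI s :
  prime s -> 'O_s(F) != 1 -> 'O_s(F) :&: C = 1 -> #|'O_s(F)| = s.
Proof. by move=> s_pr ntR tiRC; rewrite -indexg1 -tiRC -card_pcoreA card_pcoreA_prime. Qed.

(* A generator of [pcoreA s] is [r * c] with [c] of order [s] outside [F], and
   [c] must act nontrivially on some ['O_t(F)] of order [t], whence [s %| t.-1]. *)
Lemma pcore_not_sub_larger s :
    prime s -> 'O_s(F) :&: C = 1 -> ~~ ('O_s(F) \subset A) ->
  exists t, [/\ prime t, s < t, 'O_t(F) :&: C = 1 & ~~ ('O_t(F) \subset A)].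
Proof.
move=> s_pr tiRC nsRA.
have ntR : 'O_s(F) != 1 by apply: contraNneq nsRA => ->; rewrite sub1G.
have oR := card_pcore_TI s_pr ntR tiRC.
have oAs := card_pcoreA_prime s_pr ntR.
have ntAs : pcoreA s :!=: 1 by rewrite -cardG_gt1 oAs prime_gt1.
have [a Asa nt_a] := trivgPn _ ntAs.
have /setIP[Aa /mulsgP[r c Rr Cc def_a]] := Asa.
have Fr : r \in F := subsetP (pcore_sub _ _) r Rr.
have tiRA : 'O_s(F) :&: A = 1.
  by apply: contraNeq nsRA; apply: prime_meetG; rewrite oR.
have nt_c : c != 1.
  apply: contraNneq nt_a => c1; apply/eqP/set1gP; rewrite -tiRA inE Aa andbT.
  by rewrite def_a c1 mulg1.
have nRc : c \in 'N('O_s(F)) := subsetP (nCR s) c Cc.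
(* Modulo ['O_s(F)] the elements [a] and [c] agree, so [c ^+ s] falls in ['O_s(F) :&: C]. *)
have cs1 : c ^+ s = 1.
  apply/set1gP; rewrite -tiRC; apply/setIP; split; last exact: groupX.
  apply: coset_idr; rewrite ?groupX // morphX //=.
  have <- : coset 'O_s(F) a = coset 'O_s(F) c.
    by rewrite def_a mkerl ?ker_coset.
  have nRa : a \in 'N('O_s(F)).
    by rewrite def_a groupM // (subsetP (normG _)).
  have as1 : a ^+ s = 1 by have := expg_cardG Asa; rewrite oAs.
  by rewrite -morphX // as1 morph1.
have nilF := abelian_nil cFF.
(* An [s]-element of [F] lies in ['O_s(F)], which meets [C] trivially. *)
have nFc : c \notin F.
  apply: contra nt_c => Fc; apply/eqP/set1gP; rewrite -tiRC inE Cc andbT.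
  rewrite (mem_Hall_pcore (nilpotent_pcore_Hall s nilF) Fc).
  by rewrite /p_elt (pnat_dvd _ (pnat_id s_pr)) // order_dvdn cs1.
have [t t_pr ncTc] : exists2 t, prime t & c \notin 'C('O_t(F)).
  have: ~~ (F \subset 'C(<[c]>)).
    apply: contra nFc; rewrite centsC cycle_subG => cFc.
    by rewrite (subsetP sCF) // inE (subsetP sCG).
  case/(nilpotent_pcore_notin nilF)=> t t_pr; rewrite centsC cycle_subG.
  by exists t.
have ntT : 'O_t(F) != 1 by apply: contraNneq ncTc => ->; rewrite cent1T inE.
have tiTC : 'O_t(F) :&: C = 1.
  apply: contraNeq ncTc => /(pcore_meet_nontrivial t_pr)[cCT _].
  exact: subsetP cCT c Cc.
have oT := card_pcore_TI t_pr ntT tiTC.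
exists t; split=> //; last first.
  (* If ['O_t(F)] were in [A], both [r] and [a] would centralise it, hence so would [c]. *)
  apply: contra ncTc => sTA.
  have -> : c = r^-1 * a by rewrite def_a mulKg.
  apply: groupM; first by rewrite groupV (subsetP (cRF t)).
  exact: subsetP (sub_abelian_cent cAA sTA) a Aa.
have nTc : c \in 'N('O_t(F)) := subsetP (nCR t) c Cc.
pose x := conj_aut 'O_t(F) c.
have ox : #[x] = s.
  apply: nt_prime_order => //.
    by rewrite /x -morphX //= cs1 morph1.
  apply: contra ncTc => /eqP x1; rewrite -ker_conj_aut.
  by apply/kerP.
have : #[x] %| #|Aut 'O_t(F)| by rewrite order_dvdG ?Aut_aut.
rewrite ox card_Aut_cyclic ?prime_cyclic ?oT // totient_prime //.
move/dvdn_leq=> le_st; rewrite -(prednK (prime_gt0 t_pr)) ltnS le_st //.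
by rewrite -ltnS prednK ?prime_gt1 ?prime_gt0.
Qed.

Lemma der1_sub_core_mul : G^`(1) \subset gcore A G * C.
Proof.
have coverR s : prime s -> 'O_s(F) \subset gcore A G * C.
  move=> s_pr; have [tiRC|ntRC] := eqVneq ('O_s(F) :&: C) 1; last first.
    by have [] := pcore_meet_nontrivial s_pr ntRC.
  suff sRA: 'O_s(F) \subset A.
    by rewrite (subset_trans _ (mulG_subl _ _)) // gcore_max ?normal_norm.
  (* Passing to a larger prime [t] terminates because [t] is the order of ['O_t(F)], hence at most
     [#|F|]. *)
  have [n le_n] := ubnP (#|F| - s).
  elim: n s s_pr tiRC le_n => // n IHn s s_pr tiRC le_n.
  apply/negPn/negP=> nsRA.
  have [t [t_pr lt_st tiTC nsTA]] := pcore_not_sub_larger s_pr tiRC nsRA.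
  case/negP: (nsTA); apply: IHn => //; move: le_n; rewrite ltnS; apply: leq_trans.
  rewrite ltn_sub2l // (leq_trans lt_st) //.
  have ntT : 'O_t(F) != 1 by apply: contraNneq nsTA => ->; rewrite sub1G.
  by rewrite -(card_pcore_TI t_pr ntT tiTC) subset_leq_card ?pcore_sub.
apply: subset_trans sG'F _.
have nKC : C \subset 'N(gcore A G) by apply: subset_trans sCG (gcore_norm _ _).
rewrite -norm_joinEr //; apply/negPn/negP=> nsF.
have [p p_pr /negP[]] := nilpotent_pcore_notin (abelian_nil cFF) nsF.
by rewrite /= norm_joinEr // coverR.
Qed.

End CyclicFactorization.

Lemma der1_sub_gcore_mul (gT : finGroupType) (A C G : {group gT}) :
    A * C = G -> cyclic A -> cyclic C ->
    (forall s, logn s #|A| <= 1) ->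
    (forall N : {group gT}, N <| G -> N \subset C -> N :=: 1) ->
  G^`(1) \subset gcore A G * C.
Proof.
move=> defG cycA cycC sqfA coreC.
have cG' := der1_mul_abelian defG (cyclic_abelian cycA) (cyclic_abelian cycC).
have [F [cFF sG'F sFG sCF]] := der1_maximal_abelian cG'.
exact: (@der1_sub_core_mul _ A C G F).
Qed.

(** * The permutation group generated by translations and a skew morphism *)

Section SkewProduct.

Variables (gT : finGroupType) (phi : {perm gT}).
Hypotheses (cTT : abelian [set: gT]) (skew_phi : skew_morphism phi).

Definition translation (a : gT) : {perm gT} := perm (mulgI a).

Lemma translationE a b : translation a b = a * b.
Proof. by rewrite permE. Qed.

(** Permutation products apply the left factor first, so commutativity is what makes left
    translations multiply in this order. *)
Lemma translation_is_morphism :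
  {in [set: gT] &, {morph translation : a b / a * b}}.
Proof.
move=> a b _ _; apply/permP=> x; rewrite permM !translationE mulgA.
by rewrite (centsP cTT a _ b) ?inE.
Qed.
Canonical translation_morphism := Morphism translation_is_morphism.

Lemma injm_translation : 'injm translation_morphism.
Proof.
apply/injmP=> a b _ _ /(congr1 (fun s : {perm gT} => s 1)).
by rewrite /= !translationE !mulg1.
Qed.

Local Notation A := (translation_morphism @* [set: gT])%G.
Local Notation C := <[phi]>%G.

Lemma mem_translation a : translation a \in A.
Proof. exact: (mem_morphim translation_morphism) (in_setT a) (in_setT a). Qed.

Lemma skew_exponentE a i :
  skew_exponent phi a i =
    (translation a * phi == phi ^+ i * translation (phi a)).
Proof.
apply/forallP/eqP=> [ska | eq_a b].
  by apply/permP=> b; rewrite !permM !translationE (eqP (ska b)).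
have := congr1 (fun s : {perm gT} => s b) eq_a.
by rewrite !permM !translationE => ->.
Qed.

Lemma cycle_fix1 c : c \in C -> c 1 = 1.
Proof.
case/cycleP=> k ->; elim: k => [|k IHk]; first by rewrite perm1.
by rewrite expgSr permM IHk; case: skew_phi.
Qed.

(** Repeated use of [skew_exponentE] moves translations past powers of [phi], giving
    [A * C \subset C * A]; inversion shows that the two sets have equal size. *)
Lemma skew_product_group_set : group_set (A * C).
Proof.
have sAC : A * C \subset C * A.
  apply/subsetP=> _ /mulsgP[_ _ /morphimP[a _ _ ->] /cycleP[k ->] ->].
  elim: k a => [|k IHk] a.
    by rewrite mulg1 -[_ a]mul1g mem_mulg ?group1 ?mem_translation.
  have [i _] := proj2 skew_phi a; rewrite skew_exponentE => /eqP Da.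
  rewrite expgS mulgA /= Da -mulgA.
  have /mulsgP[c b Cc Ab ->] := IHk (phi a).
  by rewrite mulgA mem_mulg ?groupM ?mem_cycle.
apply/comm_group_setP/eqP; rewrite eqEcard sAC /=.
by rewrite -card_invg invMg !invGid.
Qed.

Local Notation G := (Group skew_product_group_set).

(** All conjugates of [n] in [N] fix 1; conjugating by translations, [n] fixes every point. *)
Lemma core_cycle_trivial (N : {group {perm gT}}) :
  N <| G -> N \subset C -> N :=: 1.
Proof.
case/andP=> _ nNG sNC; apply/trivgP/subsetP=> n Nn; apply/set1gP/permP=> a.
have Ga : (translation a)^-1 \in G.
  by rewrite groupV (subsetP (mulG_subl _ _)) ?mem_translation.
have Nna : n ^ (translation a)^-1 \in N by rewrite memJ_norm // (subsetP nNG).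
have := cycle_fix1 (subsetP sNC _ Nna).
rewrite conjgE invgK !permM translationE mulg1.
by move/(congr1 (translation a)); rewrite permKV translationE mulg1 perm1.
Qed.

Lemma coset_preserving_of_squarefree :
  cyclic [set: gT] -> (forall s, logn s #|[set: gT]| <= 1) ->
  coset_preserving phi.
Proof.
move=> cycT sqfT a.
pose K := (gcore A G)%G.
have sG'KC : G^`(1) \subset K * C.
  apply: der1_sub_gcore_mul => //; first exact: morphim_cyclic.
  - exact: cycle_cyclic.
  - by move=> s; rewrite card_injm ?injm_translation.
  exact: core_cycle_trivial.
have sKA : K \subset A := gcore_sub _ _.
have nKG : G \subset 'N(K) := gcore_norm _ _.
have AG x : translation x \in G.
  by rewrite (subsetP (mulG_subl _ _)) ?mem_translation.
have Gphi : phi \in G by rewrite (subsetP (mulG_subr _ _)) ?cycle_id.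
have [i_gt0 ski] := skew_powerP a skew_phi.
set i := skew_power phi a in i_gt0 ski *.
have Da : translation a * phi = phi ^+ i * translation (phi a).
  by apply/eqP; rewrite -skew_exponentE.
have tiAC : A :&: C = 1.
  apply/trivgP/subsetP=> _ /setIP[/morphimP[x _ _ ->] /cycle_fix1].
  by rewrite translationE mulg1 => ->; rewrite morph1 group1.
have nKC : C \subset 'N(K) by apply: subset_trans nKG; apply: mulG_subr.
pose u := phi a * a^-1.
have Ku : translation u \in K.
  (* By the modular law and [A :&: C = 1], it suffices to place [translation u] in [K * C]; it is a
     commutator times powers of [phi]. *)
  have {1}-> : K = A :&: (K * C) by rewrite setIC -group_modl // setIC tiAC mulg1.
  rewrite inE mem_translation -norm_joinEr //=.
  have -> : translation u = phi ^- i * [~ (translation a)^-1, phi^-1] * phi.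
    rewrite commgEl conjgE !invgK [translation a * _]mulgA Da.
    rewrite -!mulgA mulKg mulVg mulg1 translation_is_morphism ?inE //.
    by congr (_ * _); apply: (morphV translation_morphism) (in_setT a).
  have KCphi : phi \in K <*> C by rewrite (subsetP (joing_subr K C)) ?cycle_id.
  rewrite (groupMr _ KCphi) groupM ?groupV ?groupX //.
  by rewrite /= norm_joinEr // (subsetP sG'KC) // mem_commg ?groupV.
have Dphia : phi a = a * u by rewrite (centsP cTT a _ u) ?inE // mulgKV.
clearbody u.
have /morphimP[w _ _ Dw] : translation u ^ phi \in A.
  by rewrite (subsetP sKA) // memJ_norm // (subsetP nKG).
(* Since [K] is normal, [translation u] passes [phi] and becomes another translation, leaving the
   exponent [i] unchanged. *)
have Dau : translation (a * u) * phi = phi ^+ i * translation (phi a * w).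
  rewrite !translation_is_morphism ?inE // -mulgA (conjgC (translation u)) Dw.
  by rewrite !mulgA Da.
have phi_au : phi (a * u) = phi a * w.
  have := congr1 (fun s : {perm gT} => s 1) Dau.
  by rewrite !permM (cycle_fix1 (mem_cycle phi i)) !translationE !mulg1.
apply/esym/skew_power_unique => //; rewrite Dphia skew_exponentE.
by rewrite Dau phi_au.
Qed.

End SkewProduct.

Theorem theorem7p3 (p q r : nat) (hp : prime p) (hq : prime q) (hr : prime r)
    (hpq : p <> q) (hpr : p <> r) (hqr : q <> r)
    (gT : finGroupType) (hcyc : cyclic [set: gT])
    (hcard : #|[set: gT]| = (p * q * r)%N)
    (phi : {perm gT}) (hphi : skew_morphism phi) :
  coset_preserving phi.
Proof.
apply: (coset_preserving_of_squarefree (cyclic_abelian hcyc) hphi hcyc) => s.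
(* Each factor contributes 1 if it equals [s] and 0 otherwise; distinctness allows at most one 1. *)
rewrite hcard !lognM ?muln_gt0 ?prime_gt0 // !logn_prime //.
move/eqP: hpq; move/eqP: hpr; move/eqP: hqr.
have [->|_] := eqVneq s p; first by move=> _ /negPf-> /negPf->.
have [->|_] := eqVneq s q; first by move=> /negPf->.
by case: (s == r).
Qed.
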